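(* Let $\mathfrak n$ be a non-abelian $6$-dimensional nilpotent real Lie algebra with an abelian complex structure $J$. Then $\mathfrak n$ is isomorphic to one and only one of the following Lie algebras, each with basis $e_1,\dots,e_6$: \begin{itemize} \item $\mathfrak n_1 = \mathfrak h_3\times\mathbb R^3$: $[e_1,e_2]=e_6$; \item $\mathfrak n_2 = \mathfrak h_5\times\mathbb R$: $[e_1,e_2]=e_6=[e_3,e_4]$; \item $\mathfrak n_3 = \mathfrak h_3\times\mathfrak h_3$: $[e_1,e_2]=e_5$, $[e_3,e_4]=e_6$; \item $\mathfrak n_4 = \mathfrak h_3(\mathbb C)$: $[e_1,e_3]=-[e_2,e_4]=e_5$, $[e_1,e_4]=[e_2,e_3]=e_6$; \item $\mathfrak n_5$: $[e_1,e_2]=e_5$, $[e_1,e_4]=[e_2,e_3]=e_6$; \item $\mathfrak n_6$: $[e_1,e_2]=e_5$, $[e_1,e_4]=[e_2,e_5]=e_6$; \item $\mathfrak n_7$: $[e_1,e_2]=e_4$, $[e_1,e_3]=-[e_2,e_4]=e_5$, $[e_1,e_4]=[e_2,e_3]=e_6$. \end{itemize}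
   Context: An abelian complex structure on a real Lie algebra $\mathfrak g$ is a linear endomorphism $J$ of $\mathfrak g$ with $J^2=-I$ and $[Jx,Jy]=[x,y]$ for all $x,y\in\mathfrak g$. Only the nonzero brackets of basis elements are listed, up to skew-symmetry. $\mathfrak h_{2n+1}$ denotes the $(2n+1)$-dimensional real Heisenberg Lie algebra, and $\mathfrak h_3(\mathbb C)$ the realification of the $3$-dimensional complex Heisenberg Lie algebra. *)

(* Defs.v *)
From HB Require Import structures.
From mathcomp Require Import all_boot all_order all_algebra.
From mathcomp Require Export reals.
From mathcomp Require Import ring.

Set Implicit Arguments.
Unset Strict Implicit.
Unset Printing Implicit Defensive.

Import GRing.Theory.
Local Open Scope ring_scope.

HB.mixin Record Vector_isLie (F : fieldType) L of Vector F L := {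
  lie : L -> L -> L;
  lie_linearl : forall z a (x y : L), lie (a *: x + y) z = a *: lie x z + lie y z;
  lie_linearr : forall z a (x y : L), lie z (a *: x + y) = a *: lie z x + lie z y;
  liexx : forall x : L, lie x x = 0;
  lie_jacobi : forall x y z : L,
    lie x (lie y z) + lie y (lie z x) + lie z (lie x y) = 0
}.

#[short(type="lieAlgType")]
HB.structure Definition LieAlgebra (F : fieldType) :=
  { L of Vector_isLie F L & Vector F L }.

Section LieTheory.
Variables (F : fieldType) (L : lieAlgType F).
Implicit Types (x y z : L) (U V W : {vspace L}).

(* The subspace [U, V]; by bilinearity it does not depend on the chosen bases
   (mem_lie_prod and lie_prod_subP below). *)
Definition lie_prod U V : {vspace L} :=
  <<[seq lie x y | x <- vbasis U, y <- vbasis V]>>%VS.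

(* lower_central k is the (k+1)-st term of the lower central series. *)
Fixpoint lower_central (k : nat) : {vspace L} :=
  if k is k'.+1 then lie_prod fullv (lower_central k') else fullv.

Definition lie_nilpotent : Prop := exists k, lower_central k = 0%VS.

Definition lie_abelian : Prop := forall x y, lie x y = 0.

Definition abelian_complex_structure (J : 'End(L)) : Prop :=
  (forall x, J (J x) = - x) /\ (forall x y, lie (J x) (J y) = lie x y).

Lemma lie0l y : lie 0 y = 0.
Proof. by have := lie_linearl y (-1) 0 0; rewrite scaleN1r addr0 oppr0 scaleN1r addNr. Qed.

Lemma lie0r x : lie x 0 = 0.
Proof. by have := lie_linearr x (-1) 0 0; rewrite scaleN1r addr0 oppr0 scaleN1r addNr. Qed.

Lemma mem_lie_prod U V x y : x \in U -> y \in V -> lie x y \in lie_prod U V.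
Proof.
move=> /coord_vbasis-> /coord_vbasis->.
set t := \sum_(i < \dim V) _.
elim/big_rec: _ => [|i u _ IHu]; first by rewrite lie0l mem0v.
rewrite lie_linearl rpredD ?rpredZ // /t.
elim/big_rec: _ => [|j v _ IHv]; first by rewrite lie0r mem0v.
rewrite lie_linearr rpredD ?rpredZ // memv_span //.
by apply: allpairs_f; apply: mem_nth; rewrite size_tuple.
Qed.

Lemma lie_prod_subP U V W :
  reflect (forall x y, x \in U -> y \in V -> lie x y \in W)
          (lie_prod U V <= W)%VS.
Proof.
apply: (iffP idP) => [sUVW x y Ux Vy | sW].
  exact: subvP sUVW _ (mem_lie_prod Ux Vy).
apply/span_subvP => _ /allpairsP[[x y] [/= Ux Vy ->]].
by apply: sW; apply: vbasis_mem.
Qed.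

End LieTheory.

Definition lie_isomorphic (F : fieldType) (L M : lieAlgType F) : Prop :=
  exists f : 'Hom(L, M),
    bijective f /\ (forall x y, f (lie x y) = lie (f x) (f y)).

Inductive nil6_name : Set := N1 | N2 | N3 | N4 | N5 | N6 | N7.

Section Nil6.
Variable F : fieldType.

(* e_1, ..., e_6: the standard basis of F^6, numbered from 1. *)
Definition e6 (k : nat) : 'rV[F]_6 := delta_mx 0 (inord k.-1).
Local Notation e := e6.

(* An entry (i, j, v) of the list stands for [e_i, e_j] = v; brackets [e_i, e_j]
   with i < j that are not listed are zero. *)
Definition nil6_table (a : nil6_name) : seq (nat * nat * 'rV[F]_6) :=
  match a with
  | N1 => [:: (1, 2, e 6)]
  | N2 => [:: (1, 2, e 6); (3, 4, e 6)]
  | N3 => [:: (1, 2, e 5); (3, 4, e 6)]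
  | N4 => [:: (1, 3, e 5); (2, 4, - e 5); (1, 4, e 6); (2, 3, e 6)]
  | N5 => [:: (1, 2, e 5); (1, 4, e 6); (2, 3, e 6)]
  | N6 => [:: (1, 2, e 5); (1, 4, e 6); (2, 5, e 6)]
  | N7 => [:: (1, 2, e 4); (1, 3, e 5); (2, 4, - e 5); (1, 4, e 6); (2, 3, e 6)]
  end%N.

Definition coord6 (x : 'rV[F]_6) (k : nat) : F := x 0 (inord k.-1).

Definition nil6_bracket (a : nil6_name) (x y : 'rV[F]_6) : 'rV[F]_6 :=
  \sum_(t <- nil6_table a)
    (coord6 x t.1.1 * coord6 y t.1.2 - coord6 x t.1.2 * coord6 y t.1.1) *: t.2.

Definition nil6 (a : nil6_name) : Type := 'rV[F]_6.
HB.instance Definition _ a := Vector.copy (nil6 a) 'rV[F]_6.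

Lemma nil6_linearl a (z : 'rV[F]_6) c x y :
  nil6_bracket a (c *: x + y) z = c *: nil6_bracket a x z + nil6_bracket a y z.
Proof.
rewrite /nil6_bracket scaler_sumr -big_split; apply: eq_bigr => t _ /=.
rewrite scalerA -scalerDl; congr (_ *: _).
by rewrite /coord6 !mxE; ring.
Qed.

Lemma nil6_linearr a (z : 'rV[F]_6) c x y :
  nil6_bracket a z (c *: x + y) = c *: nil6_bracket a z x + nil6_bracket a z y.
Proof.
rewrite /nil6_bracket scaler_sumr -big_split; apply: eq_bigr => t _ /=.
rewrite scalerA -scalerDl; congr (_ *: _).
by rewrite /coord6 !mxE; ring.
Qed.

Lemma nil6_alt a (x : 'rV[F]_6) : nil6_bracket a x x = 0.
Proof.
rewrite /nil6_bracket big1 // => t _.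
by rewrite mulrC subrr scale0r.
Qed.

Lemma coord6_e (i j : nat) : (0 < i <= 6)%N -> (0 < j <= 6)%N ->
  coord6 (e i) j = (i == j)%:R.
Proof.
move=> /andP[i0 i6] /andP[j0 j6].
rewrite /coord6 mxE eqxx /= -val_eqE /= !inordK ?prednK //.
by rewrite -eqSS !prednK // eq_sym.
Qed.

Lemma coord6_bracket a x y k : coord6 (nil6_bracket a x y) k =
  \sum_(t <- nil6_table a)
    (coord6 x t.1.1 * coord6 y t.1.2 - coord6 x t.1.2 * coord6 y t.1.1)
      * coord6 t.2 k.
Proof. by rewrite /coord6 summxE; apply: eq_bigr => t _; rewrite mxE. Qed.

Lemma coord6N x k : coord6 (- x) k = - coord6 x k.
Proof. by rewrite /coord6 mxE. Qed.

Lemma nil6_jacobi a (x y z : 'rV[F]_6) :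
  nil6_bracket a x (nil6_bracket a y z) + nil6_bracket a y (nil6_bracket a z x)
    + nil6_bracket a z (nil6_bracket a x y) = 0.
Proof.
have rowE u v k : nil6_bracket a u v 0 k = \sum_(t <- nil6_table a)
    (coord6 u t.1.1 * coord6 v t.1.2 - coord6 u t.1.2 * coord6 v t.1.1) * t.2 0 k.
  by rewrite summxE; apply: eq_bigr => t _; rewrite mxE.
apply/rowP => k; rewrite !mxE !rowE {rowE}.
case: a; rewrite !(big_cons, big_nil) /= !coord6_bracket !(big_cons, big_nil) /=
  !(coord6N, coord6_e) //=; ring.
Qed.

HB.instance Definition _ a := Vector_isLie.Build F (nil6 a)
  (@nil6_linearl a) (@nil6_linearr a) (@nil6_alt a) (@nil6_jacobi a).

(* nil6_table lists exactly the brackets [e_i, e_j] with i < j. *)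
Lemma nil6_lieE a (i j : nat) : (0 < i < j)%N -> (j <= 6)%N ->
  lie (e i : nil6 a) (e j : nil6 a) =
  \sum_(t <- nil6_table a | (t.1.1 == i) && (t.1.2 == j)) t.2.
Proof.
move=> /andP[i0 ij] j6; rewrite [LHS]/(nil6_bracket a (e i) (e j)).
have i6 : (i <= 6)%N by apply: leq_trans (ltnW ij) j6.
have j0 : (0 < j)%N by apply: ltn_trans ij.
have coefE (p q : nat) : (0 < p < q)%N -> (q <= 6)%N ->
    coord6 (e i) p * coord6 (e j) q - coord6 (e i) q * coord6 (e j) p
    = ((p == i) && (q == j))%:R.
  move=> /andP[p0 pq] q6.
  have p6 : (p <= 6)%N by apply: leq_trans (ltnW pq) q6.
  have q0 : (0 < q)%N by apply: ltn_trans pq.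
  rewrite !coord6_e ?i0 ?j0 ?p0 ?q0 // -!natrM !mulnb.
  rewrite [X in _ - (nat_of_bool X)%:R](_ : _ = false).
    by rewrite subr0 (eq_sym p) (eq_sym q).
  by apply/negP => /andP[/eqP iq /eqP jp]; move: ij; rewrite iq jp ltnNge ltnW.
rewrite [RHS]big_mkcond /nil6_bracket /=.
case: a; rewrite !(big_cons, big_nil) /= !coefE //;
  by repeat (case: ifP => _; rewrite ?scale0r ?scale1r ?add0r ?addr0).
Qed.

End Nil6.

(* Main.v *)
Require Import Defs.
From HB Require Import structures.
From mathcomp Require Import all_boot all_order all_algebra reals.
From mathcomp Require Import ring lra.

(* Since [Jx, y] = -[x, Jy], a centralizer modulo a J-stable subspace is
   J-stable, so nilpotency yields a filtration by J-stable subspaces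
   0 < Z < Z + <y, Jy> < n with Z central of dimension 2, and every bracket is
   determined by p = [x, Jx], q = [y, Jy], r = [x, y] = [Jx, Jy] and
   s = [x, Jy] = -[Jx, y], where q, r, s lie in Z.
   If p is not in Z, it can replace y; then q = 0 by the Jacobi identity, and
   rotating x by a complex number gives n_1, n_6 or n_7 according to the rank of
   (r, s). If p lies in Z, the algebra is 2-step: replacing y by
   cy + dJy + ax + bJx, the brackets r and s can be killed modulo p, leaving
   either (p, q, 0, 0), which is n_1, n_2 or n_3, or (p, tp, r, 0), where the sign
   of t separates n_3, n_4 and n_5; p = q = 0 gives n_2 or n_4.
   The seven algebras are told apart by the nilpotency step, by whether the
   derived algebra and the next term of the lower central series are at most
   lines, and by the elements x for which ad x has rank at most 1. *)

Set Implicit Arguments.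
Unset Strict Implicit.
Unset Printing Implicit Defensive.

Import Order.TTheory GRing.Theory Num.Theory.
Local Open Scope ring_scope.

(** * Bilinear calculus, nilpotency and isomorphism of Lie algebras *)

Section LieAlgebraBasics.
Variables (F : fieldType) (L : lieAlgType F).
Implicit Types (x y z u v : L) (U : {vspace L}).

Lemma lieDl x y z : lie (x + y) z = lie x z + lie y z.
Proof. by have := lie_linearl z 1 x y; rewrite !scale1r. Qed.

Lemma lieDr z x y : lie z (x + y) = lie z x + lie z y.
Proof. by have := lie_linearr z 1 x y; rewrite !scale1r. Qed.

Lemma lieZl a x z : lie (a *: x) z = a *: lie x z.
Proof. by have := lie_linearl z a x 0; rewrite lie0l !addr0. Qed.

Lemma lieZr a x z : lie z (a *: x) = a *: lie z x.
Proof. by have := lie_linearr z a x 0; rewrite lie0r !addr0. Qed.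

Lemma lieNl x z : lie (- x) z = - lie x z.
Proof. by rewrite -scaleN1r lieZl scaleN1r. Qed.

Lemma lieNr x z : lie z (- x) = - lie z x.
Proof. by rewrite -scaleN1r lieZr scaleN1r. Qed.

Lemma lieC x y : lie x y = - lie y x.
Proof.
have := liexx (x + y); rewrite lieDl !lieDr !liexx addr0 add0r => /eqP.
by rewrite addr_eq0 => /eqP.
Qed.

Lemma lie_suml (I : Type) (s : seq I) (X : I -> L) z :
  lie (\sum_(i <- s) X i) z = \sum_(i <- s) lie (X i) z.
Proof. by elim/big_rec2: _ => [|i u v _ <-]; rewrite ?lie0l ?lieDl. Qed.

Lemma lie_sumr (I : Type) (s : seq I) (X : I -> L) z :
  lie z (\sum_(i <- s) X i) = \sum_(i <- s) lie z (X i).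
Proof. by elim/big_rec2: _ => [|i u v _ <-]; rewrite ?lie0r ?lieDr. Qed.

(* Any subspace will do, not only an ideal: take [x] outside [U] in the last
   term of the lower central series not contained in [U]. *)
Lemma nilpotent_centralized_mod U : lie_nilpotent L -> U != fullv ->
  exists2 x, x \notin U & forall y, lie x y \in U.
Proof.
move=> [k Ck0] nU; have exk : exists k, (lower_central L k <= U)%VS.
  by exists k; rewrite Ck0 sub0v.
case: (ex_minnP exk) => -[|m] Cm mmin.
  by move: nU; rewrite eqEsubv subvf (Cm : (fullv <= U)%VS).
have /subvPn[x Cx xU] : ~~ (lower_central L m <= U)%VS.
  by apply/negP => /mmin; rewrite ltnn.
exists x => // y; rewrite lieC memvN; apply: (subvP Cm).
exact: mem_lie_prod (memvf y) Cx.
Qed.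

End LieAlgebraBasics.

Lemma lie_isomorphic_sym (F : fieldType) (L M : lieAlgType F) :
  lie_isomorphic L M -> lie_isomorphic M L.
Proof.
move=> [f [[g0 fK0 gK0] fL]]; pose g : M -> L := g0.
have fK x : g (f x) = x by exact: fK0.
have gK y : f (g y) = y by exact: gK0.
have glin : linear g.
  by move=> a u v; apply: (can_inj fK); rewrite linearP /= !gK.
pose G : {linear M -> L} :=
  HB.pack g (GRing.isLinear.Build _ _ _ _ g glin).
exists (linfun G); split=> [|x y].
  by exists f => x; rewrite lfunE /= ?gK ?fK.
by apply: (can_inj fK); rewrite !lfunE /= gK fL !gK.
Qed.

Lemma lie_isomorphic_trans (F : fieldType) (L M N : lieAlgType F) :
  lie_isomorphic L M -> lie_isomorphic M N -> lie_isomorphic L N.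
Proof.
move=> [f [fb fL]] [g [gb gL]]; exists (g \o f)%VF; split=> [|x y].
  by apply: (eq_bij (bij_comp gb fb)) => x; rewrite lfunE.
by rewrite !lfunE /= fL gL.
Qed.

(** * Recognising a model algebra from six spanning vectors *)

Section Nil6Frame.
Variables (F : fieldType) (L : lieAlgType F) (a : nil6_name).
Variable X : 6.-tuple L.

(** The candidate inverse isomorphism: it sends [e6 k] to the [k]-th vector of [X], which has index
    [k.-1] because [X] is numbered from 0. *)
Definition nil6_comb (u : 'rV[F]_6) : L := \sum_i u 0 i *: X`_i.

Lemma nil6_combP c u v :
  nil6_comb (c *: u + v) = c *: nil6_comb u + nil6_comb v.
Proof.
rewrite /nil6_comb scaler_sumr -big_split; apply: eq_bigr => i _ /=.
by rewrite !mxE scalerDl scalerA.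
Qed.

HB.instance Definition _ := GRing.isLinear.Build F 'rV[F]_6 L _ nil6_comb nil6_combP.

Lemma nil6_comb_e k : (0 < k <= 6)%N -> nil6_comb (e6 F k) = X`_k.-1.
Proof.
move=> /andP[k0 k6]; rewrite /nil6_comb (bigD1 (inord k.-1)) //= big1 ?addr0.
  by rewrite mxE !eqxx scale1r inordK ?prednK.
by move=> i /negPf ik; rewrite mxE ik andbF scale0r.
Qed.

Hypothesis dimL : \dim {:L} = 6%N.
Hypothesis spanX : forall U : {vspace L}, {subset X <= U} -> forall v, v \in U.
Hypothesis lieX : forall i j : nat, (0 < i < j)%N -> (j <= 6)%N ->
  lie X`_i.-1 X`_j.-1
  = \sum_(t <- nil6_table F a | (t.1.1 == i) && (t.1.2 == j)) nil6_comb t.2.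

Lemma nil6_comb_lie (u v : nil6 F a) :
  nil6_comb (lie u v) = lie (nil6_comb u) (nil6_comb v).
Proof.
have lie_lt (i j : 'I_6) : (i < j)%N ->
  nil6_comb (lie (delta_mx 0 i : nil6 F a) (delta_mx 0 j)) = lie X`_i X`_j.
  move=> ij; rewrite (@lieX i.+1 j.+1) // -(inord_val i) -(inord_val j).
  rewrite (@nil6_lieE F a i.+1 j.+1) // linear_sum /=.
  by rewrite !inord_val.
have lie_e (i j : 'I_6) :
  nil6_comb (lie (delta_mx 0 i : nil6 F a) (delta_mx 0 j)) = lie X`_i X`_j.
  case: (ltngtP i j) => [|ji|/val_inj<-]; first exact: lie_lt.
    by rewrite lieC linearN /= lie_lt // -lieC.
  by rewrite !liexx linear0.
have sumE (w : nil6 F a) : w = \sum_i w 0 i *: (delta_mx 0 i : nil6 F a).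
  exact: (row_sum_delta (w : 'rV_6)).
rewrite {1}(sumE u) {1}(sumE v) lie_suml linear_sum lie_suml.
apply: eq_bigr => i _; rewrite !lie_sumr linear_sum; apply: eq_bigr => j _ /=.
by rewrite lieZl lieZr linearZ /= linearZ /= lie_e lieZl lieZr.
Qed.

(** Six spanning vectors in dimension 6 form a basis, and the coordinate map in that basis is
    inverse to [nil6_comb], which preserves brackets. *)
Lemma lie_isomorphic_nil6 : lie_isomorphic L (nil6 F a).
Proof.
have Xfull : <<X>>%VS = fullv.
  by apply/eqP; rewrite eqEsubv subvf; apply/subvP => v _; apply: spanX;
    apply: memv_span.
have Xfree : free X by rewrite /free Xfull dimL size_tuple.
pose f (v : L) : nil6 F a := \row_i coord X i v.
have flin : linear f by move=> c u v; apply/rowP => i; rewrite !mxE linearP.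
pose f0 : {linear L -> nil6 F a} :=
  HB.pack f (GRing.isLinear.Build _ _ _ _ f flin).
have fK : cancel f nil6_comb.
  move=> v; rewrite [RHS](@coord_span _ _ _ X) ?Xfull ?memvf //.
  by apply: eq_bigr => i _; rewrite mxE.
have gK : cancel nil6_comb f.
  by move=> u; apply/rowP => i; rewrite mxE coord_sum_free.
exists (linfun f0); split=> [|u v]; last first.
  by rewrite !lfunE /=; apply: (can_inj gK); rewrite nil6_comb_lie !fK.
by apply: (eq_bij (Bijective fK gK)) => v; rewrite lfunE.
Qed.

End Nil6Frame.

(** Spelled out bracket by bracket so that each becomes a separate computation. Spanning is
    expressed through arbitrary subspaces, the form that [frame] delivers. *)
Lemma lie_isomorphic_nil6_brackets (F : fieldType) (L : lieAlgType F)
    (a : nil6_name) (v1 v2 v3 v4 v5 v6 : L)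
    (X := [tuple v1; v2; v3; v4; v5; v6])
    (br := fun i j : nat => \sum_(t <- nil6_table F a | (t.1.1 == i) && (t.1.2 == j))
       nil6_comb X t.2) :
  \dim {:L} = 6%N ->
  (forall U : {vspace L}, v1 \in U -> v2 \in U -> v3 \in U -> v4 \in U ->
     v5 \in U -> v6 \in U -> forall v, v \in U) ->
  lie v1 v2 = br 1 2 -> lie v1 v3 = br 1 3 -> lie v1 v4 = br 1 4 ->
  lie v1 v5 = br 1 5 -> lie v1 v6 = br 1 6 -> lie v2 v3 = br 2 3 ->
  lie v2 v4 = br 2 4 -> lie v2 v5 = br 2 5 -> lie v2 v6 = br 2 6 ->
  lie v3 v4 = br 3 4 -> lie v3 v5 = br 3 5 -> lie v3 v6 = br 3 6 ->
  lie v4 v5 = br 4 5 -> lie v4 v6 = br 4 6 -> lie v5 v6 = br 5 6 ->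
  lie_isomorphic L (nil6 F a).
Proof.
move=> dimL span *; apply: (@lie_isomorphic_nil6 _ _ _ X) => // [U XU|i j].
  by apply: span; apply: XU; rewrite !inE eqxx ?orbT.
case: i => [|[|[|[|[|[|i]]]]]] //; case: j => [|[|[|[|[|[|[|j]]]]]]] //.
Qed.

(* Reduces an equality of linear combinations to one of scalars, for [ring]. *)
Lemma vect_ext (F : fieldType) (V : vectType F) (u v : V) :
  (forall phi : V -> F, (forall x y, phi (x + y) = phi x + phi y) ->
     (forall x, phi (- x) = - phi x) -> (forall a x, phi (a *: x) = a * phi x) ->
     phi 0 = 0 -> phi u = phi v) -> u = v.
Proof.
move=> phi_eq; rewrite (coord_vbasis (memvf u)) (coord_vbasis (memvf v)).
apply: eq_bigr => i _; congr (_ *: _); apply: phi_eq => [x y|x|a x|].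
- exact: linearD.
- exact: linearN.
- exact: linearZ.
- exact: linear0.
Qed.

Ltac vect_scalar := let phi := fresh in let phiD := fresh in let phiN := fresh in
  let phiZ := fresh in let phi0 := fresh in
  apply: vect_ext => phi phiD phiN phiZ phi0; rewrite !(phiD, phiN, phiZ, phi0).

Ltac vect_ring := vect_scalar; ring.

Ltac vect_field := vect_scalar; field.

Definition lieE := (lieDl, lieDr, lieNl, lieNr, lieZl, lieZr, lie0l, lie0r).

(** * Frames x, Jx, y, Jy modulo a central J-stable subspace Z *)

Section Frames.
Variables (F : rcfType) (L : lieAlgType F) (J : 'End(L)) (Z : {vspace L}).
Hypothesis dimL : \dim {:L} = 6%N.
Hypothesis abJ : abelian_complex_structure J.
Hypothesis central_l : forall u, u \in Z -> forall v, lie u v = 0.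
Hypothesis JZ : forall u, u \in Z -> J u \in Z.
Hypothesis dimZ : (\dim Z <= 2)%N.
Implicit Types (x y u v w p q r s : L) (U : {vspace L}).

Lemma JJ x : J (J x) = - x. Proof. exact: abJ.1. Qed.

Lemma lie_JJ x y : lie (J x) (J y) = lie x y. Proof. exact: abJ.2. Qed.

Lemma lie_Jl x y : lie (J x) y = - lie x (J y).
Proof. by rewrite -(lie_JJ x (J y)) JJ lieNr opprK. Qed.

Lemma central_r u : u \in Z -> forall v, lie v u = 0.
Proof. by move=> uZ v; rewrite lieC central_l ?oppr0. Qed.

(** Only an inclusion is asked, so a dependent pair is allowed when Z has dimension less than 2. *)
Definition spansZ u v := (Z <= <[u]> + <[v]>)%VS.

Lemma spansZ_sub u v U : spansZ u v -> u \in U -> v \in U -> (Z <= U)%VS.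
Proof. by move=> /subv_trans uvZ uU vU; apply: uvZ; rewrite subv_add -!memvE uU. Qed.

(** If v is off the line of u, the two lines add up to dimension at least 2, which already fills
    Z. *)
Lemma colinear_or_spansZ u v : u \in Z -> v \in Z -> u != 0 ->
  (exists c, v = c *: u) \/ spansZ u v.
Proof.
move=> uZ vZ u0; have [/vlineP vu|vu] := boolP (v \in <[u]>%VS); first by left.
right; rewrite /spansZ; suff /eqP<- : (<[u]> + <[v]>)%VS == Z by [].
have uvZ : (<[u]> + <[v]> <= Z)%VS by rewrite subv_add -!memvE uZ.
rewrite eqEdim uvZ (leq_trans dimZ) // -[2%N]/(1.+1) -{1}(_ : \dim <[u]> = 1%N).
  rewrite ltnNge; apply: contraNN vu => le_uv.
  have : (<[u]> == <[u]> + <[v]>)%VS by rewrite eqEdim addvSl.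
  by move=> /eqP->; rewrite memvE addvSr.
by rewrite dim_vline u0.
Qed.

Lemma spansZP u v w : spansZ u v -> w \in Z -> exists a b, w = a *: u + b *: v.
Proof.
move=> /subvP uvZ /uvZ /memv_addP[_ /vlineP[a ->] [_ /vlineP[b ->] ->]].
by exists a, b.
Qed.

Lemma spansZ_complement u : u \in Z -> u != 0 -> exists2 v, v \in Z & spansZ u v.
Proof.
move=> uZ u0; have [Zu|] := boolP (Z <= <[u]>)%VS.
  by exists u; rewrite // /spansZ addvv.
move=> /subvPn[v vZ vu]; exists v => //.
by case: (colinear_or_spansZ uZ vZ u0) => // -[c vE]; rewrite vE memvZ ?memv_line in vu.
Qed.

(** The vectors x, Jx, y, Jy generate the algebra modulo Z, expressed without a quotient space. *)
Definition frame x y := forall U, (Z <= U)%VS ->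
  x \in U -> J x \in U -> y \in U -> J y \in U -> forall v, v \in U.

Lemma frameC x y : frame x y -> frame y x.
Proof. by move=> fr U ZU yU JyU xU JxU; apply: fr. Qed.

(** Modulo x, Jx and Z the new vector is (c + dJ)y, and c + dJ has inverse (c - dJ) / (c^2 + d^2)
    because J^2 = -1. *)
Lemma frame_change x y c d a b u : c ^+ 2 + d ^+ 2 != 0 -> u \in Z ->
  frame x y -> frame x (c *: y + d *: J y + a *: x + b *: J x + u).
Proof.
move=> cd0 uZ fr U ZU xU JxU; rewrite !(linearD, linearZ) /= !JJ.
set y1 := (X in X \in U -> _) => y1U; set y2 := (X in X \in U -> _) => y2U.
have uU : u \in U by apply: (subvP ZU).
have JuU : J u \in U by apply: (subvP ZU); apply: JZ.
pose t1 := y1 - (a *: x + b *: J x + u).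
pose t2 := y2 - (a *: J x + b *: - x + J u).
have t1U : t1 \in U by rewrite rpredB // !rpredD ?rpredZ.
have t2U : t2 \in U by rewrite rpredB // !rpredD ?rpredZ // rpredN.
apply: fr => //.
  have -> : y = (c ^+ 2 + d ^+ 2)^-1 *: (c *: t1 - d *: t2).
    by rewrite /t1 /t2 /y1 /y2; vect_field.
  by rewrite rpredZ // rpredB // rpredZ.
have -> : J y = (c ^+ 2 + d ^+ 2)^-1 *: (d *: t1 + c *: t2).
  by rewrite /t1 /t2 /y1 /y2; vect_field.
by rewrite rpredZ // rpredD // rpredZ.
Qed.

Definition normal_frame x y p q r s :=
  [/\ frame x y, lie x (J x) = p, lie y (J y) = q, lie x y = r & lie x (J y) = s].

Lemma normal_frame_brackets x y p q r s : normal_frame x y p q r s ->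
  ((lie x (J x) = p) * (lie (J x) x = - p) * (lie y (J y) = q) *
   (lie (J y) y = - q) * (lie x y = r) * (lie y x = - r) *
   (lie (J x) (J y) = r) * (lie (J y) (J x) = - r) * (lie x (J y) = s) *
   (lie (J y) x = - s) * (lie (J x) y = - s) * (lie y (J x) = s))%type.
Proof.
move=> [_ xp yq xyr xys].
have Jxy : lie (J x) y = - s by rewrite lie_Jl xys.
have JxJy : lie (J x) (J y) = r by rewrite lie_JJ.
by rewrite xp yq xyr xys Jxy JxJy (lieC (J x) x) (lieC (J y) y) (lieC y x)
  (lieC (J y) (J x)) (lieC (J y) x) (lieC y (J x)) xp yq xyr xys Jxy JxJy opprK.
Qed.

Ltac nil6_brackets br :=
  rewrite !(big_cons, big_nil) /= ?linearN /= ?nil6_comb_e //= ?lieE ?liexx ?br;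
  vect_scalar.

(** * The model algebra attached to each normalised frame *)

Lemma normal_frame_nil6_1 x y p : normal_frame x y p 0 0 0 -> p \in Z ->
  p != 0 -> lie_isomorphic L (nil6 F N1).
Proof.
move=> nf pZ p0; have [fr _ _ _ _] := nf; have br := normal_frame_brackets nf.
have [t tZ pt] := spansZ_complement pZ p0.
pose br' := (br, central_l pZ, central_r pZ, central_l tZ, central_r tZ).
apply: (@lie_isomorphic_nil6_brackets _ _ _ x (J x) y (J y) t p) => //.
  by move=> U *; apply: fr => //; apply: (spansZ_sub pt).
all: by nil6_brackets br'; ring.
Qed.

Lemma normal_frame_nil6_2 x y p c : normal_frame x y p (c *: p) 0 0 ->
  p \in Z -> p != 0 -> c != 0 -> lie_isomorphic L (nil6 F N2).
Proof.
move=> nf pZ p0 c0; have [fr _ _ _ _] := nf; have br := normal_frame_brackets nf.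
have [t tZ pt] := spansZ_complement pZ p0.
pose br' := (br, central_l pZ, central_r pZ, central_l tZ, central_r tZ).
apply: (@lie_isomorphic_nil6_brackets _ _ _ x (J x) y (c^-1 *: J y) t p) => //.
  move=> U ? ? ? JyU ? ?; apply: fr => //; first exact: (spansZ_sub pt).
  by rewrite -(scalerK c0 (J y)) scalerA mulrC -scalerA rpredZ.
all: by nil6_brackets br'; field.
Qed.

(** Now x commutes with Jx and y with Jy, so the two Heisenberg pairs are (x, y) and (Jx, Jy). *)
Lemma normal_frame_nil6_2_isotropic x y r : normal_frame x y 0 0 r 0 ->
  r \in Z -> r != 0 -> lie_isomorphic L (nil6 F N2).
Proof.
move=> nf rZ r0; have [fr _ _ _ _] := nf; have br := normal_frame_brackets nf.
have [t tZ rt] := spansZ_complement rZ r0.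
pose br' := (br, central_l rZ, central_r rZ, central_l tZ, central_r tZ).
apply: (@lie_isomorphic_nil6_brackets _ _ _ x y (J x) (J y) t r) => //.
  by move=> U *; apply: fr => //; apply: (spansZ_sub rt).
all: by nil6_brackets br'; ring.
Qed.

Lemma normal_frame_nil6_3 x y p q : normal_frame x y p q 0 0 ->
  p \in Z -> q \in Z -> spansZ p q -> lie_isomorphic L (nil6 F N3).
Proof.
move=> nf pZ qZ pq; have [fr _ _ _ _] := nf; have br := normal_frame_brackets nf.
pose br' := (br, central_l pZ, central_r pZ, central_l qZ, central_r qZ).
apply: (@lie_isomorphic_nil6_brackets _ _ _ x (J x) y (J y) p q) => //.
  by move=> U *; apply: fr => //; apply: (spansZ_sub pq).
all: by nil6_brackets br'; ring.
Qed.

(* The degenerate elements of the pencil spanned by the two components of the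
   bracket are [p - r / t] and [p + r / t]. *)
Lemma normal_frame_nil6_3_hyperbolic x y p r t :
  normal_frame x y p (t ^+ 2 *: p) r 0 -> p \in Z -> r \in Z -> spansZ p r ->
  t != 0 -> lie_isomorphic L (nil6 F N3).
Proof.
move=> nf pZ rZ pr t0; have [fr _ _ _ _] := nf; have br := normal_frame_brackets nf.
pose br' := (br, central_l pZ, central_r pZ, central_l rZ, central_r rZ).
(* The second and fourth vectors are J applied to the first and third: the two Heisenberg factors
   are generated by commuting complex lines. *)
apply: (@lie_isomorphic_nil6_brackets _ _ _
  (x + t^-1 *: J y) (J x - t^-1 *: y) (x - t^-1 *: J y) (J x + t^-1 *: y)
  (2 *: p - (2 / t) *: r) (2 *: p + (2 / t) *: r)) => //.
  set v1 := x + _; set v2 := J x - _; set v3 := x - _; set v4 := J x + _.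
  set v5 := _ - _; set v6 := _ + _; move=> U v1U v2U v3U v4U v5U v6U.
  have pE : p = (1 / 4) *: (v5 + v6) by rewrite /v5 /v6; vect_field.
  have rE : r = (t / 4) *: (v6 - v5) by rewrite /v5 /v6; vect_field.
  have xE : x = (1 / 2) *: (v1 + v3) by rewrite /v1 /v3; vect_field.
  have JyE : J y = (t / 2) *: (v1 - v3) by rewrite /v1 /v3; vect_field.
  have JxE : J x = (1 / 2) *: (v2 + v4) by rewrite /v2 /v4; vect_field.
  have yE : y = (t / 2) *: (v4 - v2) by rewrite /v2 /v4; vect_field.
  apply: fr; first by apply: (spansZ_sub pr);
    [rewrite pE rpredZ // rpredD | rewrite rE rpredZ // rpredB].
  - by rewrite xE rpredZ // rpredD.
  - by rewrite JxE rpredZ // rpredD.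
  - by rewrite yE rpredZ // rpredB.
  - by rewrite JyE rpredZ // rpredB.
all: by nil6_brackets br'; field.
Qed.

Lemma normal_frame_nil6_4 x y r s : normal_frame x y 0 0 r s ->
  r \in Z -> s \in Z -> spansZ r s -> lie_isomorphic L (nil6 F N4).
Proof.
move=> nf rZ sZ rs; have [fr _ _ _ _] := nf; have br := normal_frame_brackets nf.
pose br' := (br, central_l rZ, central_r rZ, central_l sZ, central_r sZ).
(* Since [Jx, y] = -s and [Jx, Jy] = r, the sign in -Jx gives both [e_2, e_3] = s and [e_2, e_4] =
   -r. *)
apply: (@lie_isomorphic_nil6_brackets _ _ _ x (- J x) y (J y) r s) => //.
  move=> U ? JxU *; apply: fr => //; first exact: (spansZ_sub rs).
  by rewrite -rpredN.
all: by nil6_brackets br'; ring.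
Qed.

(** The degenerate elements of the pencil are now a complex conjugate pair. Scaling y and Jy by t^-1
    turns q into -p, and the table of h_3(C) appears after reordering. *)
Lemma normal_frame_nil6_4_elliptic x y p r t :
  normal_frame x y p (- t ^+ 2 *: p) r 0 -> p \in Z -> r \in Z -> spansZ p r ->
  t != 0 -> lie_isomorphic L (nil6 F N4).
Proof.
move=> nf pZ rZ pr t0; have [fr _ _ _ _] := nf; have br := normal_frame_brackets nf.
pose br' := (br, central_l pZ, central_r pZ, central_l rZ, central_r rZ).
apply: (@lie_isomorphic_nil6_brackets _ _ _
  x (t^-1 *: J y) (t^-1 *: y) (J x) (t^-1 *: r) p) => //.
  have scaleU (U : {vspace L}) u : t^-1 *: u \in U -> u \in U.
    by move=> /(rpredZ t); rewrite scalerA divff ?scale1r.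
  move=> U xU /scaleU JyU /scaleU yU JxU /scaleU rU pU; apply: fr => //.
  exact: (spansZ_sub pr).
all: by nil6_brackets br'; field.
Qed.

Lemma normal_frame_nil6_5 x y p r : normal_frame x y p 0 r 0 ->
  p \in Z -> r \in Z -> spansZ p r -> lie_isomorphic L (nil6 F N5).
Proof.
move=> nf pZ rZ pr; have [fr _ _ _ _] := nf; have br := normal_frame_brackets nf.
pose br' := (br, central_l pZ, central_r pZ, central_l rZ, central_r rZ).
apply: (@lie_isomorphic_nil6_brackets _ _ _ x (J x) (J y) y p r) => //.
  by move=> U *; apply: fr => //; apply: (spansZ_sub pr).
all: by nil6_brackets br'; ring.
Qed.

(** Here w = [x, Jx] takes the place of y in the frame and serves as e_6, while e_4 and e_5 are
    drawn from Z. *)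
Lemma normal_frame_nil6_1_noncentral x w : normal_frame x w w 0 0 0 ->
  lie_isomorphic L (nil6 F N1).
Proof.
move=> nf; have [fr _ _ _ _] := nf; have br := normal_frame_brackets nf.
have [t [u [tZ uZ tu]]] : exists t u, [/\ t \in Z, u \in Z & spansZ t u].
  have [Z0|] := eqVneq Z 0%VS; last first.
    rewrite -vpick0 => /(spansZ_complement (memv_pick Z))[u uZ tu].
    by exists (vpick Z), u; split; rewrite ?memv_pick.
  by exists 0, 0; split; rewrite ?mem0v // /spansZ Z0 sub0v.
pose br' := (br, central_l tZ, central_r tZ, central_l uZ, central_r uZ).
apply: (@lie_isomorphic_nil6_brackets _ _ _ x (J x) (J w) t u w) => //.
  by move=> U *; apply: fr => //; apply: (spansZ_sub tu).
all: by nil6_brackets br'; ring.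
Qed.

Lemma normal_frame_nil6_6 x w r : normal_frame x w w 0 r 0 ->
  r \in Z -> r != 0 -> lie_isomorphic L (nil6 F N6).
Proof.
move=> nf rZ r0; have [fr _ _ _ _] := nf; have br := normal_frame_brackets nf.
have [t tZ rt] := spansZ_complement rZ r0.
pose br' := (br, central_l rZ, central_r rZ, central_l tZ, central_r tZ).
(* With this choice [e_1, e_4] = [Jx, Jw] and [e_2, e_5] = [x, w], both equal to r. *)
apply: (@lie_isomorphic_nil6_brackets _ _ _ (- J x) x t (- J w) w r) => //.
  move=> U; rewrite !rpredN => *; apply: fr => //; exact: (spansZ_sub rt).
all: by nil6_brackets br'; ring.
Qed.

Lemma normal_frame_nil6_7 x w r s : normal_frame x w w 0 r s ->
  r \in Z -> s \in Z -> spansZ r s -> lie_isomorphic L (nil6 F N7).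
Proof.
move=> nf rZ sZ rs; have [fr _ _ _ _] := nf; have br := normal_frame_brackets nf.
pose br' := (br, central_l rZ, central_r rZ, central_l sZ, central_r sZ).
apply: (@lie_isomorphic_nil6_brackets _ _ _ x (J x) (J w) w s r) => //.
  by move=> U *; apply: fr => //; apply: (spansZ_sub rs).
all: by nil6_brackets br'; ring.
Qed.

(** * Changes of frame and reduction to the normal forms *)

Lemma frameP x y v : frame x y -> exists a b c d : F, exists2 u, u \in Z &
  v = a *: x + b *: J x + c *: y + d *: J y + u.
Proof.
pose U := (<[x]> + <[J x]> + <[y]> + <[J y]> + Z)%VS.
have subl (A B : {vspace L}) w : w \in A -> w \in (A + B)%VS.
  exact: (subvP (addvSl A B)).
have subr (A B : {vspace L}) w : w \in B -> w \in (A + B)%VS.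
  exact: (subvP (addvSr A B)).
move=> /(_ U (addvSr _ _)) frU; have : v \in U.
  apply: frU; rewrite /U.
  - by do 4!apply/subl; apply: memv_line.
  - by do 3!apply/subl; apply/subr; apply: memv_line.
  - by do 2!apply/subl; apply/subr; apply: memv_line.
  - by apply/subl; apply/subr; apply: memv_line.
case/memv_addP => t4 /memv_addP[t3 /memv_addP[t2 /memv_addP[_ /vlineP[a ->]
  [_ /vlineP[b ->] ->]] [_ /vlineP[c ->] ->]] [_ /vlineP[d ->] ->]] [u uZ ->].
by exists a, b, c, d, u.
Qed.

Lemma normal_frameC x y p q r s :
  normal_frame x y p q r s -> normal_frame y x q p (- r) s.
Proof.
move=> nf; have br := normal_frame_brackets nf; have [fr _ _ _ _] := nf.
by split; rewrite ?br //; apply: frameC.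
Qed.

(** In complex notation, r + is is multiplied by c - id and shifted by (b + ia)p. This is how r and
    s are removed modulo p. *)
Lemma normal_frame_change x y p q r s c d a b u :
  p \in Z -> u \in Z -> c ^+ 2 + d ^+ 2 != 0 -> normal_frame x y p q r s ->
  normal_frame x (c *: y + d *: J y + a *: x + b *: J x + u) p
    ((c ^+ 2 + d ^+ 2) *: q + (a ^+ 2 + b ^+ 2) *: p
       + (2 * (c * b - d * a)) *: r + (2 * (c * a + d * b)) *: s)
    (c *: r + d *: s + b *: p) (c *: s - d *: r + a *: p).
Proof.
move=> pZ uZ cd0 nf; have br := normal_frame_brackets nf.
have [fr _ _ _ _] := nf; have JuZ := JZ uZ.
split; rewrite ?br //; first exact: frame_change.
all: rewrite ?(linearD, linearZ) /= ?JJ !lieE ?liexx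
  ?(br, central_l uZ, central_r uZ, central_l JuZ, central_r JuZ); vect_ring.
Qed.

Definition is_nil6 := exists a, lie_isomorphic L (nil6 F a).

Lemma normal_frame_is_nil6_anisotropic x y p q r s : normal_frame x y p q r s ->
  p \in Z -> q \in Z -> r \in Z -> s \in Z -> p != 0 -> is_nil6.
Proof.
move=> nf pZ qZ rZ sZ p0.
wlog s0 : y q r s nf qZ rZ sZ / s = 0.
  move=> IH.
  (* Coefficients that make the new s vanish. If s = gp, a shift by -gx suffices; otherwise p and s
     span Z, and r = al p + be s gives c = be, d = 1, a = al. *)
  have [c [d [a [cd0 sE]]]] : exists c d a,
      c ^+ 2 + d ^+ 2 != 0 /\ c *: s - d *: r + a *: p = 0.
    case: (colinear_or_spansZ pZ sZ p0) => [[g ->]|ps].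
      exists 1, 0, (- g); split; last by vect_ring.
      by rewrite expr1n expr0n addr0 oner_neq0.
    have [al [be ->]] := spansZP ps rZ.
    exists be, 1, al; split; last by vect_ring.
    by rewrite gt_eqF // expr1n ltr_wpDl ?sqr_ge0.
  by apply: (IH _ _ _ _ (normal_frame_change a 0 pZ (mem0v Z) cd0 nf)) => //;
    rewrite ?sE ?mem0v // ?rpredD ?rpredZ ?mem0v.
have one0 : 1 ^+ 2 + 0 ^+ 2 != 0 :> F by rewrite expr1n expr0n addr0 oner_neq0.
move: nf sZ; rewrite s0 => nf _.
case: (colinear_or_spansZ pZ rZ p0) => [[g rE]|pr].
  have := normal_frame_change 0 (- g) pZ (mem0v Z) one0 nf.
  set y' := (X in normal_frame x X); set q' := (X in normal_frame x y' p X).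
  rewrite [X in normal_frame x y' p q' X](_ : _ = 0); last first.
    by rewrite rE; vect_ring.
  rewrite [X in normal_frame x y' p q' 0 X](_ : _ = 0); last by vect_ring.
  have q'Z : q' \in Z by rewrite /q' !rpredD ?rpredZ ?mem0v.
  case: (colinear_or_spansZ pZ q'Z p0) => [[d ->]|pq'] nf'; last first.
    by exists N3; apply: normal_frame_nil6_3 nf' _ _ _.
  have [d0|d0] := eqVneq d 0; last first.
    by exists N2; apply: normal_frame_nil6_2 nf' _ _ _.
  by move: nf'; rewrite d0 scale0r => nf'; exists N1; apply: normal_frame_nil6_1 nf' _ _.
have [al [be qE]] := spansZP pr qZ.
(* Completing the square: the term 2br with b = -be/2 cancels the r-component of q and leaves q
   proportional to p. *)
have := normal_frame_change 0 (- be / 2) pZ (mem0v Z) one0 nf.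
set y' := (X in normal_frame x X).
rewrite [X in normal_frame x y' p X](_ : _ = (al + be ^+ 2 / 4) *: p); last first.
  by rewrite qE; vect_field.
rewrite [X in normal_frame x y' p _ _ X](_ : _ = 0); last by vect_ring.
set r' := (X in normal_frame x y' p _ X).
have r'Z : r' \in Z by rewrite /r' !rpredD ?rpredZ ?mem0v.
have pr' : spansZ p r'.
  apply: (spansZ_sub pr); first by rewrite (subvP (addvSl _ _)) ?memv_line.
  have -> : r = (be / 2) *: p + r' by rewrite /r'; vect_field.
  by rewrite memv_add ?memvZ ?memv_line.
(* The pencil of the two bracket components has Pfaffian d alpha^2 - beta^2, so the sign of d
   decides; the cases come in the order positive, negative, zero. *)
move: (al + _) => d nf'; have [d_lt0|d_gt0|d0] := ltrgt0P d.
- exists N3; apply: (@normal_frame_nil6_3_hyperbolic x y' p r' (Num.sqrt d)) => //.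
    by rewrite sqr_sqrtr // ltW.
  by rewrite gt_eqF // sqrtr_gt0.
- exists N4; apply: (@normal_frame_nil6_4_elliptic x y' p r' (Num.sqrt (- d))) => //.
    by rewrite sqr_sqrtr ?opprK // oppr_ge0 ltW.
  by rewrite gt_eqF // sqrtr_gt0 oppr_gt0.
- exists N5; apply: (@normal_frame_nil6_5 x y' p r') => //.
  by move: nf'; rewrite d0 scale0r.
Qed.

Lemma normal_frame_is_nil6 x y p q r s : ~ lie_abelian L ->
  normal_frame x y p q r s ->
  p \in Z -> q \in Z -> r \in Z -> s \in Z -> is_nil6.
Proof.
move=> nab nf pZ qZ rZ sZ.
have [p0|p0] := eqVneq p 0; last exact: normal_frame_is_nil6_anisotropic nf _ _ _ _ _.
have [q0|q0] := eqVneq q 0; last first.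
  by apply: normal_frame_is_nil6_anisotropic (normal_frameC nf) _ _ _ _ _;
    rewrite ?rpredN.
move: nf; rewrite {p pZ}p0 {q qZ}q0 => nf.
have zE c d : (c ^+ 2 + d ^+ 2) *: (0 : L) + (0 ^+ 2 + 0 ^+ 2) *: 0
    + (2 * (c * 0 - d * 0)) *: r + (2 * (c * 0 + d * 0)) *: s = 0 by vect_ring.
have [r0|r0] := eqVneq r 0.
  have [s0|s0] := eqVneq s 0.
    case: nab => u v; have br := normal_frame_brackets nf; have [fr _ _ _ _] := nf.
    have [a [b [c [d [e eZ ->]]]]] := frameP u fr.
    have [a' [b' [c' [d' [e' e'Z ->]]]]] := frameP v fr.
    rewrite !lieE ?liexx.
    rewrite ?(br, central_l eZ, central_r eZ, central_l e'Z, central_r e'Z) r0 s0.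
    by vect_ring.
  (* Replacing y by Jy moves s into the place of r. *)
  have cd0 : 0 ^+ 2 + 1 ^+ 2 != 0 :> F by rewrite expr1n expr0n add0r oner_neq0.
  have := normal_frame_change 0 0 (mem0v Z) (mem0v Z) cd0 nf.
  rewrite zE r0 !(scaler0, scale0r, add0r, addr0, scale1r, oppr0) => nf'.
  by exists N2; apply: normal_frame_nil6_2_isotropic nf' _ _.
case: (colinear_or_spansZ rZ sZ r0) => [[g sE]|rs]; last first.
  by exists N4; apply: normal_frame_nil6_4 nf _ _ _.
(* For s = gr, replacing y by y + gJy kills s and multiplies r by 1 + g^2. *)
have cd0 : 1 ^+ 2 + g ^+ 2 != 0 :> F by rewrite gt_eqF // expr1n ltr_wpDr ?sqr_ge0.
have := normal_frame_change 0 0 (mem0v Z) (mem0v Z) cd0 nf.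
rewrite zE sE; set y' := (X in normal_frame x X).
rewrite [X in normal_frame x y' 0 0 X](_ : _ = (1 ^+ 2 + g ^+ 2) *: r); last by vect_ring.
rewrite [X in normal_frame x y' 0 0 _ X](_ : _ = 0); last by vect_ring.
move=> nf'; exists N2; apply: normal_frame_nil6_2_isotropic nf' _ _.
  by rewrite rpredZ.
by rewrite scaler_eq0 negb_or cd0.
Qed.

(** Multiplying x by a + bJ scales w = [x, Jx] by k = a^2 + b^2, hence multiplies r + is by k(a +
    ib). *)
Lemma normal_frame_rotate x w r s a b : a ^+ 2 + b ^+ 2 != 0 ->
  normal_frame x w w 0 r s ->
  normal_frame (a *: x + b *: J x) ((a ^+ 2 + b ^+ 2) *: w)
    ((a ^+ 2 + b ^+ 2) *: w) 0 ((a ^+ 2 + b ^+ 2) *: (a *: r - b *: s))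
    ((a ^+ 2 + b ^+ 2) *: (a *: s + b *: r)).
Proof.
move=> k0 nf; have br := normal_frame_brackets nf; have [fr _ _ _ _] := nf.
split.
- have := @frame_change w x _ _ 0 0 _ k0 (mem0v Z) (frameC fr).
  rewrite !scale0r !addr0 => /frameC; set k := a ^+ 2 + b ^+ 2 in k0 *.
  have kk0 : k ^+ 2 + 0 ^+ 2 != 0 by rewrite expr0n addr0 expf_neq0.
  by move=> /(@frame_change _ _ _ _ 0 0 _ kk0 (mem0v Z)); rewrite !scale0r !addr0.
all: rewrite ?(linearD, linearZ) /= ?JJ !lieE ?liexx ?br; vect_ring.
Qed.

Lemma three_step_is_nil6 x y c d u : frame x y -> (forall v, lie y v \in Z) ->
  u \in Z -> lie x (J x) = c *: y + d *: J y + u -> lie x (J x) \notin Z ->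
  is_nil6.
Proof.
move=> fr yZ uZ; set w := lie x (J x) => wE wZ.
(* Otherwise w would equal u and lie in Z. *)
have cd0 : c ^+ 2 + d ^+ 2 != 0.
  apply: contraNneq wZ => /eqP; rewrite paddr_eq0 ?sqr_ge0 // !sqrf_eq0.
  by case/andP => /eqP c0 /eqP d0; rewrite wE c0 d0 !scale0r !add0r.
have frw : frame x w.
  by have := @frame_change x y _ _ 0 0 _ cd0 uZ fr; rewrite !scale0r !addr0 -wE.
have JyZ v : lie (J y) v \in Z by rewrite lie_Jl rpredN.
have wvZ v : lie w v \in Z.
  by rewrite wE !lieE (central_l uZ) addr0 rpredD // rpredZ.
have rZ : lie x w \in Z by rewrite lieC rpredN.
have sZ : lie x (J w) \in Z by rewrite lieC rpredN lie_Jl rpredN.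
have wJw : lie w (J w) = 0.
  (* Two of the three Jacobi terms vanish because [Jx, Jw] = [x, w] and [Jw, x] lie in Z; the third
     is [Jw, w]. *)
  have := lie_jacobi x (J x) (J w).
  rewrite lie_JJ (lieC (J w) x) lieNr (central_r rZ) (central_r sZ) oppr0 !add0r.
  by rewrite -/w lieC => /eqP; rewrite oppr_eq0 => /eqP.
have nf : normal_frame x w w 0 (lie x w) (lie x (J w)) by [].
have [r0|r0] := eqVneq (lie x w) 0; last first.
  case: (colinear_or_spansZ rZ sZ r0) => [[g sE]|rs]; last first.
    by exists N7; apply: normal_frame_nil6_7 nf _ _ _.
  (* Rotation by 1 - ig turns r + is = (1 + ig)r into a real multiple of r. *)
  have k0 : 1 ^+ 2 + (- g) ^+ 2 != 0 :> F.
    by rewrite gt_eqF // expr1n ltr_wpDr ?sqr_ge0.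
  have := normal_frame_rotate k0 nf; rewrite sE.
  set k := (1 ^+ 2 + (- g) ^+ 2) in k0 *; move: (lie x w) rZ r0 => r rZ r0.
  rewrite [X in normal_frame _ _ _ _ X](_ : _ = (k * k) *: r); last first.
    by rewrite /k; vect_ring.
  rewrite [X in normal_frame _ _ _ _ _ X](_ : _ = 0); last by vect_ring.
  move=> nf'; exists N6; apply: normal_frame_nil6_6 nf' _ _; first by rewrite rpredZ.
  by rewrite scaler_eq0 negb_or mulf_neq0.
move: nf; rewrite r0; move: (lie x (J w)) sZ => s sZ nf.
have [s0|s0] := eqVneq s 0.
  by move: nf; rewrite s0 => nf; exists N1; apply: normal_frame_nil6_1_noncentral nf.
(* Rotation by i carries (0, s) to (-s, 0). *)
have k0 : 0 ^+ 2 + 1 ^+ 2 != 0 :> F by rewrite expr1n expr0n add0r oner_neq0.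
have := normal_frame_rotate k0 nf.
rewrite [X in normal_frame _ _ _ _ X](_ : _ = - s); last by vect_ring.
rewrite [X in normal_frame _ _ _ _ _ X](_ : _ = 0); last by vect_ring.
move=> nf'; exists N6; apply: normal_frame_nil6_6 nf' _ _; first by rewrite rpredN.
by rewrite oppr_eq0.
Qed.


End Frames.

(** * J-stable subspaces and the filtration of a nilpotent algebra *)

Section ComplexSubspaces.
Variables (F : rcfType) (V : vectType F) (J : 'End(V)).
Hypothesis JJ : forall x, J (J x) = - x.
Implicit Types (x : V) (U : {vspace V}).

Definition add_complex_line U x := (U + (<[x]> + <[J x]>))%VS.

Lemma dim_add_complex_line_le U x :
  (\dim (add_complex_line U x) <= \dim U + 2)%N.
Proof.
apply: leq_trans (dimv_add_leqif _ _).1 _; rewrite leq_add2l.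
apply: leq_trans (dimv_add_leqif _ _).1 _.
by rewrite !dim_vline; case: (_ == 0); case: (_ == 0).
Qed.

Lemma dim_add_vline U x : x \notin U -> (\dim U < \dim (U + <[x]>))%N.
Proof.
move=> xU; rewrite ltnNge; apply: contra xU => le_Ux.
have /eqP-> : (U == U + <[x]>)%VS by rewrite eqEdim addvSl.
by rewrite memvE addvSr.
Qed.

Lemma add_complex_line_closed U x : (forall u, u \in U -> J u \in U) ->
  forall u, u \in add_complex_line U x -> J u \in add_complex_line U x.
Proof.
move=> JU _ /memv_addP[u uU [_ /memv_addP[_ /vlineP[a ->] [_ /vlineP[b ->] ->]] ->]].
rewrite !linearD !linearZ /= JJ scalerN -scaleNr.
by rewrite memv_add ?JU // addrC memv_add ?memvZ ?memv_line.
Qed.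

(** If Jx = u + cx with u in U, applying J gives (1 + c^2)x = -(Ju + cu), and 1 + c^2 is nonzero
    over a real field, so x would lie in U. *)
Lemma dim_add_complex_line_ge U x : (forall u, u \in U -> J u \in U) ->
  x \notin U -> (\dim U + 2 <= \dim (add_complex_line U x))%N.
Proof.
move=> JU xU; rewrite addn2 /add_complex_line addvA.
apply: leq_ltn_trans (dim_add_vline xU) (dim_add_vline _).
apply: contra xU => /memv_addP[u uU [_ /vlineP[c ->] JxE]].
have k0 : 1 + c ^+ 2 != 0 by rewrite gt_eqF // ltr_wpDr ?sqr_ge0.
have -> : x = (1 + c ^+ 2)^-1 *: (- (J u + c *: u)).
  have Ju : J u = - x - c *: J x.
    by have := JJ x; rewrite {1}JxE linearD linearZ /= => <-; rewrite addrK.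
  have uE : u = J x - c *: x by rewrite JxE addrK.
  by rewrite Ju uE; vect_field.
by rewrite rpredZ // rpredN rpredD ?rpredZ ?JU.
Qed.

Lemma add_complex_lineP U x v : v \in add_complex_line U x ->
  exists a b, exists2 u, u \in U & v = a *: x + b *: J x + u.
Proof.
move=> /memv_addP[u uU [_ /memv_addP[_ /vlineP[a ->] [_ /vlineP[b ->] ->]] ->]].
by exists a, b, u; rewrite // addrC.
Qed.

Lemma add_complex_line_sub U x W : (U <= W)%VS -> x \in W -> J x \in W ->
  (add_complex_line U x <= W)%VS.
Proof. by move=> UW xW JxW; rewrite !subv_add UW -!memvE xW. Qed.

End ComplexSubspaces.

Lemma abelian_complex_is_nil6 (F : rcfType) (L : lieAlgType F) (J : 'End(L)) :
  \dim {:L} = 6%N -> lie_nilpotent L -> ~ lie_abelian L ->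
  abelian_complex_structure J -> is_nil6 L.
Proof.
move=> dimL nilL nab abJ; have JJ := abJ.1.
have neq_full (U : {vspace L}) : (\dim U < 6)%N -> U != fullv.
  by apply: contraTneq => ->; rewrite dimL.
have [|z z0 zc] := nilpotent_centralized_mod nilL (_ : 0%VS != fullv).
  by apply: neq_full; rewrite dimv0.
have J0 u : u \in 0%VS -> J u \in 0%VS by rewrite !memv0 => /eqP->; rewrite linear0.
pose Z := add_complex_line J 0%VS z.
have JZ : forall u, u \in Z -> J u \in Z := add_complex_line_closed JJ J0.
have dimZ : (\dim Z <= 2)%N.
  by have := dim_add_complex_line_le J 0%VS z; rewrite dimv0.
have dimZ' := dim_add_complex_line_ge JJ J0 z0; rewrite dimv0 in dimZ'.
have zC v : lie z v = 0 by apply/eqP; rewrite -memv0.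
have centralZ u : u \in Z -> forall v, lie u v = 0.
  move=> /add_complex_lineP[a [b [w]]]; rewrite memv0 => /eqP-> -> v.
  by rewrite !lieE lie_Jl // !zC oppr0 !scaler0 !addr0.
have [|y yZ yc] := nilpotent_centralized_mod nilL (_ : Z != fullv).
  by apply: neq_full; apply: leq_ltn_trans dimZ _.
pose Z2 := add_complex_line J Z y.
have JZ2 : forall u, u \in Z2 -> J u \in Z2 := add_complex_line_closed JJ JZ.
have dimZ2 := dim_add_complex_line_ge JJ JZ yZ.
have [|x xZ2 xc] := nilpotent_centralized_mod nilL (_ : Z2 != fullv).
  apply: neq_full; apply: leq_ltn_trans (dim_add_complex_line_le _ _ _) _.
  by apply: (@leq_ltn_trans (2 + 2)); rewrite ?leq_add2r.
have dimZ3 := dim_add_complex_line_ge JJ JZ2 xZ2.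
(* Each of the three complex lines z, y, x adds two dimensions, which exhausts dimension 6. *)
have full : add_complex_line J Z2 x = fullv.
  apply/eqP; rewrite eqEdim subvf dimL.
  apply: leq_trans dimZ3; apply: (@leq_add 4 2) => //.
  by apply: leq_trans dimZ2; apply: (@leq_add 2 2).
have fr : frame J Z x y.
  move=> U ZU xU JxU yU JyU v; apply: (subvP _ v (memvf v)).
  by rewrite -full; do 2!apply: add_complex_line_sub => //.
have [pZ|pZ] := boolP (lie x (J x) \in Z).
  have nf : normal_frame J Z x y (lie x (J x)) (lie y (J y)) (lie x y) (lie x (J y)).
    by [].
  apply: (normal_frame_is_nil6 dimL abJ centralZ JZ dimZ nab nf pZ (yc _)).
    by rewrite lieC rpredN.
  by rewrite -[lie _ _]opprK -lie_Jl // rpredN lieC rpredN.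
have [c [d [u uZ pE]]] := add_complex_lineP (xc (J x)).
exact: (three_step_is_nil6 dimL abJ centralZ JZ dimZ fr yc uZ pE pZ).
Qed.

(** * Isomorphism invariants *)

Section Invariants.
Variables (F : fieldType) (L : lieAlgType F).

Definition colinear_family (I : Type) (v : I -> L) :=
  exists w, forall i, exists c, v i = c *: w.

Definition two_step := forall x y z : L, lie x (lie y z) = 0.

Definition derived_line := colinear_family (fun t : L * L => lie t.1 t.2).

Definition third_line :=
  colinear_family (fun t : L * L * L => lie t.1.1 (lie t.1.2 t.2)).

(** Separates n_1 from n_2: in h_5 x R one Heisenberg pair commutes with the other without being
    central. *)
Definition plane_centralizer_central := forall x y u : L, lie x y <> 0 ->
  lie x u = 0 -> lie y u = 0 -> forall v, lie u v = 0.

Definition ad_line (x : L) := colinear_family (lie x).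

(** Separates n_4 from n_3 and n_5: in h_3(C) the map ad x is complex linear, so its real rank is
    never 1. *)
Definition noncentral_ad_line := exists x y : L, lie x y <> 0 /\ ad_line x.

(** Separates n_3 from n_5: in n_5 the elements with ad of rank at most 1 commute with one
    another. *)
Definition noncommuting_ad_lines :=
  exists x y : L, [/\ lie x y <> 0, ad_line x & ad_line y].

End Invariants.

Section Transport.
Variables (F : fieldType) (L M : lieAlgType F) (f : 'Hom(L, M)) (g : M -> L).
Hypotheses (fK : forall x, g (f x) = x) (gK : forall y, f (g y) = y).
Hypothesis f_lie : forall x y, f (lie x y) = lie (f x) (f y).

Lemma transport_neq0 x y : lie x y <> 0 -> lie (f x) (f y) <> 0.
Proof. by rewrite -f_lie -(linear0 f) => xy0 /(can_inj fK). Qed.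

Lemma transport_eq0 y y' : lie y y' = 0 -> lie (g y) (g y') = 0.
Proof. by move=> yy'; apply: (can_inj fK); rewrite f_lie !gK linear0. Qed.

Lemma transport_ad_line x : ad_line x -> ad_line (f x).
Proof.
move=> [w xw]; exists (f w) => y; have [c xc] := xw (g y).
by exists c; rewrite -(gK y) -f_lie xc linearZ.
Qed.

Lemma transport_two_step : two_step L -> two_step M.
Proof. by move=> nL x y z; rewrite -(gK x) -(gK y) -(gK z) -!f_lie nL linear0. Qed.

Lemma transport_derived_line : derived_line L -> derived_line M.
Proof.
move=> [w Lw]; exists (f w) => -[x y]; have [c xyc] := Lw (g x, g y).
by exists c; rewrite /= -(gK x) -(gK y) -f_lie xyc linearZ.
Qed.

Lemma transport_third_line : third_line L -> third_line M.
Proof.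
move=> [w Lw]; exists (f w) => -[[x y] z]; have [c xyc] := Lw (g x, g y, g z).
by exists c; rewrite /= -(gK x) -(gK y) -(gK z) -!f_lie xyc linearZ.
Qed.

Lemma transport_plane_centralizer_central :
  plane_centralizer_central L -> plane_centralizer_central M.
Proof.
move=> Lc x y u xy0 /transport_eq0 xu /transport_eq0 yu v.
rewrite -(gK u) -(gK v) -f_lie (Lc _ _ _ _ xu yu) ?linear0 // => gxy0.
by apply: xy0; rewrite -(gK x) -(gK y) -f_lie gxy0 linear0.
Qed.

Lemma transport_noncentral_ad_line :
  noncentral_ad_line L -> noncentral_ad_line M.
Proof.
move=> [x [y [xy0 xl]]]; exists (f x), (f y).
by split; [apply: transport_neq0 | apply: transport_ad_line].
Qed.

Lemma transport_noncommuting_ad_lines :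
  noncommuting_ad_lines L -> noncommuting_ad_lines M.
Proof.
move=> [x [y [xy0 xl yl]]]; exists (f x), (f y).
by split; [apply: transport_neq0 | apply: transport_ad_line | apply: transport_ad_line].
Qed.

End Transport.

Lemma lie_isomorphic_invariants (F : fieldType) (L M : lieAlgType F) :
  lie_isomorphic L M ->
  [/\ two_step L -> two_step M, derived_line L -> derived_line M,
      third_line L -> third_line M &
      [/\ plane_centralizer_central L -> plane_centralizer_central M,
          noncentral_ad_line L -> noncentral_ad_line M &
          noncommuting_ad_lines L -> noncommuting_ad_lines M]].
Proof.
move=> [f [[g fK gK] f_lie]]; split; last split.
- exact: (transport_two_step gK f_lie).
- exact: (transport_derived_line gK f_lie).
- exact: (transport_third_line gK f_lie).
- exact: (transport_plane_centralizer_central fK gK f_lie).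
- exact: (transport_noncentral_ad_line fK gK f_lie).
- exact: (transport_noncommuting_ad_lines fK gK f_lie).
Qed.

(** * Values of the invariants on the seven models *)

Section Nil6Invariants.
Variable F : rcfType.
Notation e := (e6 F).

Lemma nil6_ext (u v : 'rV[F]_6) :
  coord6 u 1 = coord6 v 1 -> coord6 u 2 = coord6 v 2 -> coord6 u 3 = coord6 v 3 ->
  coord6 u 4 = coord6 v 4 -> coord6 u 5 = coord6 v 5 -> coord6 u 6 = coord6 v 6 ->
  u = v.
Proof.
move=> *; apply/rowP => -[i i6].
have -> : Ordinal i6 = inord i.+1.-1 by apply: val_inj; rewrite /= inordK.
by case: i i6 => [|[|[|[|[|[|i]]]]]].
Qed.

Lemma coord6_lie a (x y : nil6 F a) k : coord6 (lie x y) k =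
  \sum_(t <- nil6_table F a)
    (coord6 x t.1.1 * coord6 y t.1.2 - coord6 x t.1.2 * coord6 y t.1.1)
      * coord6 t.2 k.
Proof. exact: coord6_bracket. Qed.

Lemma coord6Z c (x : 'rV[F]_6) k : coord6 (c *: x) k = c * coord6 x k.
Proof. by rewrite /coord6 mxE. Qed.

Lemma coord6_0 k : coord6 (0 : 'rV[F]_6) k = 0.
Proof. by rewrite /coord6 mxE. Qed.

Definition wedge6 (x y : 'rV[F]_6) i j :=
  coord6 x i * coord6 y j - coord6 x j * coord6 y i.

Ltac expand_coord6_lie := do !split;
  rewrite coord6_lie /wedge6 !(big_cons, big_nil) /= ?coord6N !coord6_e //=; ring.

Lemma coord6_lie1 (x y : nil6 F N1) :
  ((coord6 (lie x y) 1 = 0) *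
   (coord6 (lie x y) 2 = 0) *
   (coord6 (lie x y) 3 = 0) *
   (coord6 (lie x y) 4 = 0) *
   (coord6 (lie x y) 5 = 0) *
   (coord6 (lie x y) 6 = wedge6 x y 1 2))%type.
Proof. by expand_coord6_lie. Qed.

Lemma coord6_lie2 (x y : nil6 F N2) :
  ((coord6 (lie x y) 1 = 0) *
   (coord6 (lie x y) 2 = 0) *
   (coord6 (lie x y) 3 = 0) *
   (coord6 (lie x y) 4 = 0) *
   (coord6 (lie x y) 5 = 0) *
   (coord6 (lie x y) 6 = (wedge6 x y 1 2 + wedge6 x y 3 4)%R))%type.
Proof. by expand_coord6_lie. Qed.

Lemma coord6_lie3 (x y : nil6 F N3) :
  ((coord6 (lie x y) 1 = 0) *
   (coord6 (lie x y) 2 = 0) *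
   (coord6 (lie x y) 3 = 0) *
   (coord6 (lie x y) 4 = 0) *
   (coord6 (lie x y) 5 = wedge6 x y 1 2) *
   (coord6 (lie x y) 6 = wedge6 x y 3 4))%type.
Proof. by expand_coord6_lie. Qed.

Lemma coord6_lie4 (x y : nil6 F N4) :
  ((coord6 (lie x y) 1 = 0) *
   (coord6 (lie x y) 2 = 0) *
   (coord6 (lie x y) 3 = 0) *
   (coord6 (lie x y) 4 = 0) *
   (coord6 (lie x y) 5 = (wedge6 x y 1 3 - wedge6 x y 2 4)%R) *
   (coord6 (lie x y) 6 = (wedge6 x y 1 4 + wedge6 x y 2 3)%R))%type.
Proof. by expand_coord6_lie. Qed.

Lemma coord6_lie5 (x y : nil6 F N5) :
  ((coord6 (lie x y) 1 = 0) *
   (coord6 (lie x y) 2 = 0) *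
   (coord6 (lie x y) 3 = 0) *
   (coord6 (lie x y) 4 = 0) *
   (coord6 (lie x y) 5 = wedge6 x y 1 2) *
   (coord6 (lie x y) 6 = (wedge6 x y 1 4 + wedge6 x y 2 3)%R))%type.
Proof. by expand_coord6_lie. Qed.

Lemma coord6_lie6 (x y : nil6 F N6) :
  ((coord6 (lie x y) 1 = 0) *
   (coord6 (lie x y) 2 = 0) *
   (coord6 (lie x y) 3 = 0) *
   (coord6 (lie x y) 4 = 0) *
   (coord6 (lie x y) 5 = wedge6 x y 1 2) *
   (coord6 (lie x y) 6 = (wedge6 x y 1 4 + wedge6 x y 2 5)%R))%type.
Proof. by expand_coord6_lie. Qed.

Lemma coord6_lie7 (x y : nil6 F N7) :
  ((coord6 (lie x y) 1 = 0) *
   (coord6 (lie x y) 2 = 0) *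
   (coord6 (lie x y) 3 = 0) *
   (coord6 (lie x y) 4 = wedge6 x y 1 2) *
   (coord6 (lie x y) 5 = (wedge6 x y 1 3 - wedge6 x y 2 4)%R) *
   (coord6 (lie x y) 6 = (wedge6 x y 1 4 + wedge6 x y 2 3)%R))%type.
Proof. by expand_coord6_lie. Qed.

Definition coord6_lieE := (coord6_lie1, coord6_lie2, coord6_lie3, coord6_lie4,
  coord6_lie5, coord6_lie6, coord6_lie7).

Ltac nil6_coords := rewrite ?coord6_lieE /wedge6 ?coord6_lieE /wedge6
  ?(coord6Z, coord6N, coord6_0, mul0r, mulr0, addr0, subr0, oppr0) ?coord6_e //=.

(** The 2 x 2 minors of a family of rank at most 1 vanish; a single nonzero minor thus refutes
    colinearity. *)
Lemma colinear_minor a (I : Type) (v : I -> nil6 F a) i j k l :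
  colinear_family v ->
  coord6 (v i) k * coord6 (v j) l = coord6 (v i) l * coord6 (v j) k.
Proof. by move=> [w vw]; have [c ->] := vw i; have [d ->] := vw j; nil6_coords; ring. Qed.

Ltac coord6_neq k :=
  let E := fresh in move=> /(congr1 (fun u : 'rV[F]_6 => coord6 u k)) E;
  move: E; nil6_coords; lra.

Ltac minor_neq i j k l :=
  let E := fresh in move=> /(@colinear_minor _ _ _ i j k l) /= E;
  move: E; nil6_coords; lra.

Lemma two_step_nil6 a :
  two_step (nil6 F a) <-> (if a is (N6 | N7) then False else True).
Proof.
case: a; split=> //.
1-5: by move=> _ x y z; apply: nil6_ext; nil6_coords; ring.
- by move=> /(_ (e 2) (e 1) (e 2)); coord6_neq 6%N.
- by move=> /(_ (e 1) (e 1) (e 2)); coord6_neq 6%N.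
Qed.

Lemma derived_line_nil6 a :
  derived_line (nil6 F a) <-> (if a is (N1 | N2) then True else False).
Proof.
case: a; split=> //.
1-2: by move=> _; exists (e 6) => -[x y]; exists (coord6 (lie x y) 6);
  apply: nil6_ext; nil6_coords; ring.
- by minor_neq (e 1 : nil6 F N3, e 2 : nil6 F N3)
    (e 3 : nil6 F N3, e 4 : nil6 F N3) 5%N 6%N.
- by minor_neq (e 1 : nil6 F N4, e 3 : nil6 F N4)
    (e 1 : nil6 F N4, e 4 : nil6 F N4) 5%N 6%N.
- by minor_neq (e 1 : nil6 F N5, e 2 : nil6 F N5)
    (e 1 : nil6 F N5, e 4 : nil6 F N5) 5%N 6%N.
- by minor_neq (e 1 : nil6 F N6, e 2 : nil6 F N6)
    (e 1 : nil6 F N6, e 4 : nil6 F N6) 5%N 6%N.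
- by minor_neq (e 1 : nil6 F N7, e 2 : nil6 F N7)
    (e 1 : nil6 F N7, e 4 : nil6 F N7) 4%N 6%N.
Qed.

Lemma third_line_nil6 a :
  third_line (nil6 F a) <-> (if a is N7 then False else True).
Proof.
case: a; split=> //.
1-5: by move=> _; exists 0 => -[[x y] z]; exists 0; rewrite scaler0;
  apply: (two_step_nil6 _).2.
- by move=> _; exists (e 6) => -[[x y] z]; exists (coord6 (lie x (lie y z)) 6);
    apply: nil6_ext; nil6_coords; ring.
- by minor_neq (e 1 : nil6 F N7, e 1 : nil6 F N7, e 2 : nil6 F N7)
    (e 2 : nil6 F N7, e 1 : nil6 F N7, e 2 : nil6 F N7) 5%N 6%N.
Qed.

Lemma plane_centralizer_central_nil6_1 : plane_centralizer_central (nil6 F N1).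
Proof.
move=> x y u xy0 xu yu v; apply: nil6_ext; nil6_coords; try by ring.
move: xu => /(congr1 (fun u : 'rV[F]_6 => coord6 u 6)).
move: yu => /(congr1 (fun u : 'rV[F]_6 => coord6 u 6)).
nil6_coords => yu xu.
(* The equations [x, u] = [y, u] = 0 are a linear system in the first two coordinates of u, with
   this determinant; Cramer's rule makes both zero. *)
have d0 : coord6 x 1 * coord6 y 2 - coord6 x 2 * coord6 y 1 != 0.
  by apply/eqP => d0; apply: xy0; apply: nil6_ext; nil6_coords.
have u1 : coord6 u 1 = 0.
  apply: (mulfI d0); transitivity (coord6 y 1 * 0 - coord6 x 1 * 0); last by ring.
  by rewrite -{1}xu -yu; ring.
have u2 : coord6 u 2 = 0.
  apply: (mulfI d0); transitivity (coord6 y 2 * 0 - coord6 x 2 * 0); last by ring.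
  by rewrite -{1}xu -yu; ring.
by rewrite u1 u2; ring.
Qed.

Lemma not_plane_centralizer_central_nil6_2 : ~ plane_centralizer_central (nil6 F N2).
Proof.
move=> /(_ (e 1) (e 2) (e 3)) H; have {H} : lie (e 3 : nil6 F N2) (e 4) = 0.
  apply: H; first by coord6_neq 6%N.
    by apply: nil6_ext; nil6_coords; ring.
  by apply: nil6_ext; nil6_coords; ring.
by coord6_neq 6%N.
Qed.

Lemma noncommuting_ad_lines_nil6_3 : noncommuting_ad_lines (nil6 F N3).
Proof.
exists (e 1), (e 2); split; first by coord6_neq 5%N.
all: exists (e 5) => y; set v := lie _ y; exists (coord6 v 5); rewrite /v.
all: by apply: nil6_ext; nil6_coords; ring.
Qed.

Lemma noncentral_ad_line_nil6_3 : noncentral_ad_line (nil6 F N3).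
Proof.
by have [x [y [xy0 xl _]]] := noncommuting_ad_lines_nil6_3; exists x, y.
Qed.

Lemma not_noncentral_ad_line_nil6_4 : ~ noncentral_ad_line (nil6 F N4).
Proof.
move=> [x [y [xy0 xl]]]; apply: xy0.
have := colinear_minor (e 1) (e 2) 5 6 xl.
have := colinear_minor (e 3) (e 4) 5 6 xl.
nil6_coords => m34 m12.
(* The minors say x_1^2 + x_2^2 = 0 and x_3^2 + x_4^2 = 0. *)
have [x1 x2] : coord6 x 1 = 0 /\ coord6 x 2 = 0 by split; nra.
have [x3 x4] : coord6 x 3 = 0 /\ coord6 x 4 = 0 by split; nra.
by apply: nil6_ext; nil6_coords; rewrite ?(x1, x2, x3, x4); ring.
Qed.

Lemma noncentral_ad_line_nil6_5 : noncentral_ad_line (nil6 F N5).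
Proof.
exists (e 4), (e 1); split; first by coord6_neq 6%N.
exists (e 6) => y; exists (- coord6 y 1).
by apply: nil6_ext; nil6_coords; ring.
Qed.

Lemma not_noncommuting_ad_lines_nil6_5 : ~ noncommuting_ad_lines (nil6 F N5).
Proof.
have ad_lineE (x : nil6 F N5) : ad_line x -> coord6 x 1 = 0 /\ coord6 x 2 = 0.
  move=> xl; have := colinear_minor (e 2) (e 4) 5 6 xl.
  have := colinear_minor (e 1) (e 3) 5 6 xl.
  (* The minors reduce to x_2^2 = 0 and x_1^2 = 0. *)
  by nil6_coords => m13 m24; split; nra.
move=> [x [y [xy0 /ad_lineE[x1 x2] /ad_lineE[y1 y2]]]]; apply: xy0.
by apply: nil6_ext; nil6_coords; rewrite ?(x1, x2, y1, y2); ring.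
Qed.

(** Every invariant transports both ways along the isomorphism, and each two distinct models differ
    in one of them; what remains is propositional. *)
Lemma nil6_inj a b : lie_isomorphic (nil6 F a) (nil6 F b) -> a = b.
Proof.
move=> iso; have iso' := lie_isomorphic_sym iso.
have [t d r [p n m]] := lie_isomorphic_invariants iso.
have [t' d' r' [p' n' m']] := lie_isomorphic_invariants iso'.
have ta := two_step_nil6 a; have tb := two_step_nil6 b.
have da := derived_line_nil6 a; have db := derived_line_nil6 b.
have ra := third_line_nil6 a; have rb := third_line_nil6 b.
have p1 := plane_centralizer_central_nil6_1.
have p2 := not_plane_centralizer_central_nil6_2.
have m3 := noncommuting_ad_lines_nil6_3.
have n3 := noncentral_ad_line_nil6_3.
have n4 := not_noncentral_ad_line_nil6_4.
have n5 := noncentral_ad_line_nil6_5.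
have m5 := not_noncommuting_ad_lines_nil6_5.
move: iso iso' => _ _.
case: a t d r p n m t' d' r' p' n' m' ta da ra;
  case: b tb db rb => //; tauto.
Qed.

End Nil6Invariants.

Theorem theorem3p2 (R : realType) (n : lieAlgType R) (J : 'End(n)) :
  \dim {:n} = 6%N ->
  lie_nilpotent n ->
  ~ lie_abelian n ->
  abelian_complex_structure J ->
  exists! a : nil6_name, lie_isomorphic n (nil6 R a).
Proof.
move=> dim6 nil nab abJ.
have [a iso_a] := abelian_complex_is_nil6 dim6 nil nab abJ.
exists a; split=> // b iso_b; apply: (@nil6_inj R).
exact: lie_isomorphic_trans (lie_isomorphic_sym iso_a) iso_b.
Qed.
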